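(* Let $\Sigma_1, \Sigma_2$ be two sets such that the intersection $\Sigma_1 \cap \Sigma_2 = \{x_0\}$ is a singleton. Let $K_1: \Sigma_1\times\Sigma_1\to\mathbb{C}$ and $K_2:\Sigma_2\times\Sigma_2\to\mathbb{C}$ be two positive definite kernels on $\Sigma_1$ and $\Sigma_2$ respectively. Assume that \[ K_1(x_0, x_0) = K_2(x_0, x_0) = 1. \] Then the Markov product $K_1 *_{x_0} K_2$ of $K_1$ and $K_2$ is a positive definite kernel on $\Sigma_1\cup\Sigma_2$.
   Context: Throughout, ''positive definite'' means ''non-negative definite'' (for matrices: Hermitian positive semidefinite). A map $K:\Sigma\times\Sigma\to\mathbb{C}$ on a set $\Sigma$ is called a positive definite kernel if for each $k\in\mathbb{N}$ and each choice of elements $\sigma_1,\dots,\sigma_k\in\Sigma$, the square matrix $[K(\sigma_i,\sigma_j)]_{1\le i,j\le k}$ is positive definite. Markov product: let $\Sigma_1,\Sigma_2$ be sets with $\Sigma_1\cap\Sigma_2=\{x_0\}$ and let $K_i:\Sigma_i\times\Sigma_i\to\mathbb{C}$ ($i=1,2$) be kernels with $K_1(x_0,x_0)=K_2(x_0,x_0)=1$. The Markov product $K_1*_{x_0}K_2$ is the kernel on $\Sigma_1\cup\Sigma_2$ defined by: (1) $[K_1*_{x_0}K_2]\big|_{\Sigma_i\times\Sigma_i}=K_i$ for $i=1,2$; (2) for $\sigma_1\in\Sigma_1$ and $\sigma_2\in\Sigma_2$, \[ [K_1*_{x_0}K_2](\sigma_1,\sigma_2)=K_1(\sigma_1,x_0)\,K_2(x_0,\sigma_2)\quad\text{and}\quad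 [K_1*_{x_0}K_2](\sigma_2,\sigma_1)=\overline{[K_1*_{x_0}K_2](\sigma_1,\sigma_2)}. \] *)

(* Defs.v *)
From mathcomp Require Import all_boot all_order all_algebra.
From mathcomp Require Import sesquilinear spectral.
From mathcomp Require Import boolp classical_sets reals.
From mathcomp.real_closed Require Export complex.

Set Implicit Arguments.
Unset Strict Implicit.
Unset Printing Implicit Defensive.

Import Order.TTheory GRing.Theory Num.Theory.
Local Open Scope classical_set_scope.
Local Open Scope sesquilinear_scope.
Local Open Scope ring_scope.

(* In [complex R] the order relation [0 <= z] means that z is real and
   nonnegative. *)
Definition psdmx (R : realType) (n : nat) (A : 'M[complex R]_n) : Prop :=
  A \is hermsymmx /\
  forall v : 'cV[complex R]_n, 0 <= (v ^t* *m A *m v) 0 0.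

(* A kernel on a subset S of T is represented by a function on T, of which
   only the values on S x S are meaningful. *)
Definition pd_kernel (R : realType) (T : Type) (S : set T)
    (K : T -> T -> complex R) : Prop :=
  forall (k : nat) (s : 'I_k -> T), (forall i, S (s i)) ->
    psdmx (\matrix_(i < k, j < k) K (s i) (s j)).

(* The clauses overlap only when x or y is the common point x0; the lemmas
   below show that they then agree. The value 0 outside of S1 `|` S2 is
   irrelevant. *)
Definition markov_product (R : realType) (T : Type) (S1 S2 : set T) (x0 : T)
    (K1 K2 : T -> T -> complex R) (x y : T) : complex R :=
  if (x \in S1) && (y \in S1) then K1 x y
  else if (x \in S2) && (y \in S2) then K2 x y
  else if (x \in S1) && (y \in S2) then K1 x x0 * K2 x0 y
  else if (x \in S2) && (y \in S1) then (K1 y x0 * K2 x0 x)^*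
  else 0.

Lemma pd_kernel_conj (R : realType) (T : Type) (S : set T)
    (K : T -> T -> complex R) (x y : T) :
  pd_kernel S K -> S x -> S y -> K y x = (K x y)^*.
Proof.
move=> pdK Sx Sy.
have Ss (i : 'I_2) : S (if i == 0 then x else y) by case: ifP.
have [/is_hermitianmxP/matrixP/(_ 1 0) + _] := pdK 2%N _ Ss.
by rewrite expr0 scale1r !mxE /=.
Qed.

Lemma markov_product1 (R : realType) (T : Type) (S1 S2 : set T) (x0 : T)
    (K1 K2 : T -> T -> complex R) (x y : T) :
  S1 x -> S1 y -> markov_product S1 S2 x0 K1 K2 x y = K1 x y.
Proof. by move=> /mem_set Sx /mem_set Sy; rewrite /markov_product Sx Sy. Qed.

Lemma markov_product2 (R : realType) (T : Type) (S1 S2 : set T) (x0 : T)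
    (K1 K2 : T -> T -> complex R) (x y : T) :
  S1 `&` S2 = [set x0] -> K1 x0 x0 = 1 -> K2 x0 x0 = 1 ->
  S2 x -> S2 y -> markov_product S1 S2 x0 K1 K2 x y = K2 x y.
Proof.
move=> S12 K1x0 K2x0 Sx Sy; rewrite /markov_product.
case: ifPn => [/andP[/set_mem S1x /set_mem S1y]|_]; last by rewrite (mem_set Sx) (mem_set Sy).
have -> : x = x0 by have : (S1 `&` S2) x by []; rewrite S12.
have -> : y = x0 by have : (S1 `&` S2) y by []; rewrite S12.
by rewrite K1x0 K2x0.
Qed.

Lemma markov_product12 (R : realType) (T : Type) (S1 S2 : set T) (x0 : T)
    (K1 K2 : T -> T -> complex R) (x y : T) :
  S1 `&` S2 = [set x0] -> K1 x0 x0 = 1 -> K2 x0 x0 = 1 ->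
  S1 x -> S2 y ->
  markov_product S1 S2 x0 K1 K2 x y = K1 x x0 * K2 x0 y.
Proof.
move=> S12 K1x0 K2x0 S1x S2y.
have [S1y|nS1y] := pselect (S1 y).
  have -> : y = x0 by have : (S1 `&` S2) y by []; rewrite S12.
  have [S1x0 _] : (S1 `&` S2) x0 by rewrite S12.
  by rewrite markov_product1// K2x0 mulr1.
have [S2x|nS2x] := pselect (S2 x).
  have -> : x = x0 by have : (S1 `&` S2) x by []; rewrite S12.
  have [_ S2x0] : (S1 `&` S2) x0 by rewrite S12.
  by rewrite markov_product2// K1x0 mul1r.
by rewrite /markov_product (memNset nS1y) (memNset nS2x) (mem_set S1x)
  (mem_set S2y).
Qed.

Lemma markov_product21 (R : realType) (T : Type) (S1 S2 : set T) (x0 : T)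
    (K1 K2 : T -> T -> complex R) (x y : T) :
  S1 `&` S2 = [set x0] -> pd_kernel S1 K1 -> pd_kernel S2 K2 ->
  K1 x0 x0 = 1 -> K2 x0 x0 = 1 -> S1 x -> S2 y ->
  markov_product S1 S2 x0 K1 K2 y x = (markov_product S1 S2 x0 K1 K2 x y)^*.
Proof.
move=> S12 pdK1 pdK2 K1x0 K2x0 S1x S2y.
have [S1y|nS1y] := pselect (S1 y).
  by rewrite !markov_product1// (pd_kernel_conj pdK1).
have [S2x|nS2x] := pselect (S2 x).
  by rewrite !markov_product2// (pd_kernel_conj pdK2).
rewrite (markov_product12 S12 K1x0 K2x0 S1x S2y).
by rewrite /markov_product (memNset nS1y) (memNset nS2x) (mem_set S1x)
  (mem_set S2y).
Qed.

(* Main.v *)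
Require Import Defs.
From mathcomp Require Import all_boot all_order all_algebra.
From mathcomp Require Import sesquilinear.
From mathcomp Require Import boolp classical_sets reals.
From mathcomp Require Import ring.
Import Order.TTheory GRing.Theory Num.Theory.
Local Open Scope classical_set_scope.
Local Open Scope sesquilinear_scope.
Local Open Scope ring_scope.

(** Normalise at the common point: if [K x0 x0 = 1], subtracting from [K] the
    rank-one kernel [K x x0 * K x0 y] leaves a positive definite kernel, the
    Schur complement of [K] at [x0], and this complement vanishes as soon as
    one of its arguments is [x0].

    Let [p i] retract the union of the two sets onto the [i]-th one by sending
    every other point to [x0], and let [K i'] be the Schur complement of [K i]
    at [x0].  On the union, the Markov product is then
      [K1' (p1 x) (p1 y) + K2' (p2 x) (p2 y) + a x * (a y)^*]
    where [a x = K1 (p1 x) x0 * K2 (p2 x) x0].  Indeed, if [x] and [y] are both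
    in the first set then the second summand vanishes and the third one restores
    what was subtracted from [K1]; if they are in different sets then the first
    two summands vanish and the third one is the product which defines the
    Markov product there.  Each of the three summands is positive definite
    ([pd_kernel_schur], [pd_kernel_comp], [pd_kernel_rank1]), hence so is
    their sum. *)

Lemma pd_kernelP {R : realType} {T : Type} (S : set T)
    (K : T -> T -> complex R) :
  pd_kernel S K <->
  (forall x y, S x -> S y -> K y x = (K x y)^*) /\
  (forall k (s : 'I_k -> T) (v : 'I_k -> complex R), (forall i, S (s i)) ->
    0 <= \sum_i \sum_j (v i)^* * K (s i) (s j) * v j).
Proof.
have formE k (s : 'I_k -> T) (v : 'cV[complex R]_k) :
    (v ^t* *m (\matrix_(i < k, j < k) K (s i) (s j)) *m v) 0 0
    = \sum_i \sum_j (v i 0)^* * K (s i) (s j) * v j 0.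
  rewrite mxE exchange_big; apply: eq_bigr => j _.
  by rewrite mxE mulr_suml; apply: eq_bigr => i _; rewrite !mxE.
split=> [pdK|[hK pK] k s Ss].
  split=> [x y Sx Sy|k s v Ss]; first exact: pd_kernel_conj pdK Sx Sy.
  have [_ /(_ (\col_i v i))] := pdK k s Ss.
  rewrite formE; congr (_ <= _).
  by apply: eq_bigr => i _; apply: eq_bigr => j _; rewrite !mxE.
split; last by move=> v; rewrite formE; apply: pK.
apply/is_hermitianmxP/matrixP => i j.
by rewrite expr0 scale1r !mxE; apply: hK.
Qed.

Lemma eq_pd_kernel {R : realType} {T : Type} (S : set T)
    (K L : T -> T -> complex R) :
  (forall x y, S x -> S y -> K x y = L x y) ->
  pd_kernel S L -> pd_kernel S K.
Proof.
move=> eqKL pdL k s Ss.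
suff -> : \matrix_(i < k, j < k) K (s i) (s j)
  = \matrix_(i < k, j < k) L (s i) (s j) by exact: pdL.
by apply/matrixP => i j; rewrite !mxE eqKL.
Qed.

Lemma pd_kernel_comp {R : realType} {T U : Type} (S : set T) (S' : set U)
    (f : U -> T) (K : T -> T -> complex R) :
  (forall x, S' x -> S (f x)) ->
  pd_kernel S K -> pd_kernel S' (fun x y => K (f x) (f y)).
Proof. by move=> fS pdK k s Ss; apply: (pdK k (f \o s)) => i; apply: fS. Qed.

Lemma pd_kernelD {R : realType} {T : Type} (S : set T)
    (K L : T -> T -> complex R) :
  pd_kernel S K -> pd_kernel S L -> pd_kernel S (fun x y => K x y + L x y).
Proof.
move=> /pd_kernelP[hK pK] /pd_kernelP[hL pL]; apply/pd_kernelP.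
split=> [x y Sx Sy|k s v Ss]; first by rewrite rmorphD /= hK// hL.
under eq_bigr do under eq_bigr do rewrite mulrDr mulrDl.
under eq_bigr do rewrite big_split.
by rewrite big_split addr_ge0 ?pK ?pL.
Qed.

(** The quadratic form of this kernel is the squared modulus of
    [\sum_j (a (s j))^* * v j]. *)
Lemma pd_kernel_rank1 {R : realType} {T : Type} (S : set T)
    (a : T -> complex R) :
  pd_kernel S (fun x y => a x * (a y)^*).
Proof.
apply/pd_kernelP; split=> [x y _ _|k s v _].
  by rewrite rmorphM /= conjCK mulrC.
pose w := \sum_j (a (s j))^* * v j.
suff -> : \sum_i \sum_j (v i)^* * (a (s i) * (a (s j))^*) * v j = w * w^*.
  exact: mul_conjC_ge0.
rewrite mulrC rmorph_sum /= mulr_suml; apply: eq_bigr => i _.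
rewrite mulr_sumr; apply: eq_bigr => j _.
by rewrite rmorphM /= conjCK; ring.
Qed.

(** The value of the quadratic form of the Schur complement at [v] is that of
    [K] itself once the point [x0] is added to the family with a suitable
    weight: minimising over that weight is completing the square. *)
Lemma pd_kernel_schur {R : realType} {T : Type} (S : set T) (x0 : T)
    (K : T -> T -> complex R) :
  S x0 -> K x0 x0 = 1 -> pd_kernel S K ->
  pd_kernel S (fun x y => K x y - K x x0 * K x0 y).
Proof.
move=> Sx0 K1 /pd_kernelP[hK pK]; apply/pd_kernelP.
split=> [x y Sx Sy|k s v Ss].
  by rewrite rmorphB rmorphM /= -!hK// [K x0 x * _]mulrC.
pose w := \sum_j K x0 (s j) * v j.
have wC : w^* = \sum_i (v i)^* * K (s i) x0.
  rewrite rmorph_sum /=; apply: eq_bigr => i _.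
  by rewrite rmorphM /= -hK// mulrC.
(* The form is minimal for the weight [- w] at [x0], because [K x0 x0 = 1]. *)
pose s' i := oapp s x0 (unlift ord0 i).
pose v' i := oapp v (- w) (unlift ord0 i).
have Ss' i : S (s' i) by rewrite /s'; case: unliftP => [j|] _ /=.
have := pK k.+1 s' v' Ss'; congr (_ <= _).
rewrite big_ord_recl big_ord_recl /s' /v' unlift_none /= K1.
under eq_bigr do rewrite liftK /= -mulrA.
under [X in _ + X]eq_bigr do rewrite liftK big_ord_recl unlift_none /=.
under [X in _ + X]eq_bigr do under eq_bigr do rewrite liftK /=.
rewrite -mulr_sumr -/w big_split -mulr_suml -wC rmorphN /=.
under [RHS]eq_bigr do under eq_bigr do rewrite mulrBr mulrBl.
under [RHS]eq_bigr do rewrite sumrB.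
rewrite sumrB.
have -> : \sum_i \sum_j (v i)^* * (K (s i) x0 * K x0 (s j)) * v j = w^* * w.
  rewrite wC mulr_suml; apply: eq_bigr => i _.
  by rewrite mulr_sumr; apply: eq_bigr => j _; ring.
by ring.
Qed.

Theorem theorem1p2 (R : realType) (T : Type) (S1 S2 : set T) (x0 : T)
    (K1 K2 : T -> T -> complex R) :
  S1 `&` S2 = [set x0] ->
  pd_kernel S1 K1 -> pd_kernel S2 K2 ->
  K1 x0 x0 = 1 -> K2 x0 x0 = 1 ->
  pd_kernel (S1 `|` S2) (markov_product S1 S2 x0 K1 K2).
Proof.
move=> S12 pdK1 pdK2 K1x0 K2x0.
have [S1x0 S2x0] : (S1 `&` S2) x0 by rewrite S12.
pose p (S : set T) x := if x \in S then x else x0.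
have pS S x : S x0 -> S (p S x) by rewrite /p; case: ifP => // /set_mem.
have p_id S x : S x -> p S x = x by move=> Sx; rewrite /p mem_set.
have p12 x : S1 x -> p S2 x = x0.
  rewrite /p; case: ifP => // /set_mem S2x S1x.
  by have : (S1 `&` S2) x by []; rewrite S12.
have p21 x : S2 x -> p S1 x = x0.
  rewrite /p; case: ifP => // /set_mem S1x S2x.
  by have : (S1 `&` S2) x by []; rewrite S12.
pose a x := K1 (p S1 x) x0 * K2 (p S2 x) x0.
have aC x : (a x)^* = K1 x0 (p S1 x) * K2 x0 (p S2 x).
  rewrite rmorphM /= -(pd_kernel_conj pdK1) -?(pd_kernel_conj pdK2) //;
    exact: pS.
pose schur (K : T -> T -> complex R) x y := K x y - K x x0 * K x0 y.
apply: (@eq_pd_kernel _ _ _ _ (fun x y => schur K1 (p S1 x) (p S1 y)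
  + schur K2 (p S2 x) (p S2 y) + a x * (a y)^*)); last first.
  apply: pd_kernelD; last exact: pd_kernel_rank1.
  apply: pd_kernelD.
    apply: (pd_kernel_comp S1 _ (p S1) (schur K1)).
      by move=> x _; apply: pS.
    exact: pd_kernel_schur.
  apply: (pd_kernel_comp S2 _ (p S2) (schur K2)).
    by move=> x _; apply: pS.
  exact: pd_kernel_schur.
move=> x y; rewrite aC /a /schur => -[Sx|Sx] [Sy|Sy].
- by rewrite markov_product1// !(p_id S1)// !p12// K2x0; ring.
- rewrite markov_product12// (p_id _ _ Sx) (p_id _ _ Sy) (p12 _ Sx) (p21 _ Sy).
  by rewrite K1x0 K2x0; ring.
- rewrite markov_product21// markov_product12// rmorphM /=.
  rewrite -(pd_kernel_conj pdK1)// -(pd_kernel_conj pdK2)//.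
  rewrite (p_id _ _ Sx) (p_id _ _ Sy) (p12 _ Sy) (p21 _ Sx) K1x0 K2x0.
  by ring.
- by rewrite markov_product2// !(p_id S2)// !p21// K1x0; ring.
Qed.
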